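(* Let the loss $f(\cdot,z)$ be convex and $\beta$-smooth for all $z\in\mathcal{Z}$. Consider full-batch GD with $T$ iterations and learning rates $\eta_t\le1/(2\beta)$ for all $t\le T+1$. Then $$|\epsilon_{\mathrm{gen}}|\le\frac{4\sqrt{2\beta(\epsilon_{\mathrm{opt}}+\epsilon_{\mathbf{c}})\,\epsilon_{\mathrm{path}}}}{n}\sqrt{\sum_{t=1}^T\eta_t}+8\beta\frac{\epsilon_{\mathrm{path}}}{n^2}\sum_{t=1}^T\eta_t .$$
   Context: Let $\mathcal{D}$ be a distribution on $\mathcal{Z}$ and $z_1,\dots,z_n$ i.i.d. from $\mathcal{D}$; $S=(z_1,\dots,z_n)$. The loss $f:\mathbb{R}^d\times\mathcal{Z}\to[0,\infty)$ is non-negative; $\beta$-smooth means $\|\nabla f(w,z)-\nabla f(u,z)\|_2\le\beta\|w-u\|_2$. $R(w)=\mathbb{E}_{Z\sim\mathcal{D}}[f(w,Z)]$, $R_S(w)=\frac1n\sum_j f(w,z_j)$, $W^*_S$ a minimizer of $R_S$ (assumed to exist). Full-batch GD: from a fixed $W_1$, $W_{t+1}=W_t-\frac{\eta_t}{n}\sum_{j=1}^n\nabla f(W_t,z_j)$, $t=1,\dots,T$, output $A(S)=W_{T+1}$. Definitions: $\epsilon_{\mathrm{gen}}=\mathbb{E}[R(A(S))-R_S(A(S))]$; $\epsilon_{\mathrm{opt}}=\mathbb{E}[R_S(A(S))-R_S(W^*_S)]$; $\epsilon_{\mathbf{c}}=\mathbb{E}[R_S(W^*_S)]$; $\epsilon_{\mathrm{path}}=\sum_{t=1}^T\eta_t\mathbb{E}[\|\nabla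 f(W_t,z_i)\|_2^2]$ for a fixed index $i$. *)

(* Defs.v *)
From mathcomp Require Import all_boot all_algebra.
From mathcomp Require Import all_classical all_reals all_analysis.
Set Implicit Arguments.
Unset Strict Implicit.
Unset Printing Implicit Defensive.
Import GRing.Theory Num.Theory.
Local Open Scope ring_scope.
Local Open Scope classical_set_scope.

Section Defs.
Variable R : realType.
Variable d : nat.

Definition sqnorm2 (v : 'rV[R]_d) : R := \sum_(j < d) (v 0 j) ^+ 2.
Definition norm2 (v : 'rV[R]_d) : R := Num.sqrt (sqnorm2 v).

Definition grad (g : 'rV[R]_d -> R) (w : 'rV[R]_d) : 'rV[R]_d :=
  \row_(j < d) ('D_(delta_mx 0 j : 'rV[R]_d) g w).

Definition smooth (beta : R) (g : 'rV[R]_d -> R) : Prop :=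
  (forall w, differentiable g w) /\
  (forall w u, norm2 (grad g w - grad g u) <= beta * norm2 (w - u)).

Definition convex_fun (g : 'rV[R]_d -> R) : Prop :=
  forall (x y : 'rV[R]_d) (t : R), 0 <= t <= 1 ->
    g (t *: x + (1 - t) *: y) <= t * g x + (1 - t) * g y.

Variables (Z : Type) (n : nat).

Definition emp_risk (f : 'rV[R]_d -> Z -> R) (s : 'I_n -> Z) (w : 'rV[R]_d) : R :=
  n%:R^-1 * \sum_(j < n) f w (s j).

(* full-batch GD: gd_iter f eta W1 s k = W_{k+1};
   W_1 = W1, W_{t+1} = W_t - (eta_t / n) sum_j grad f(W_t, z_j) *)
Fixpoint gd_iter (f : 'rV[R]_d -> Z -> R) (eta : nat -> R) (W1 : 'rV[R]_d)
    (s : 'I_n -> Z) (k : nat) : 'rV[R]_d :=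
  match k with
  | 0 => W1
  | k'.+1 =>
      let W := gd_iter f eta W1 s k' in
      W - (eta k'.+1 / n%:R) *: \sum_(j < n) grad (f^~ (s j)) W
  end.

Definition gd_out f eta W1 s (T : nat) := gd_iter f eta W1 s T.

End Defs.

Section Prob.
Variables (dO dZ : measure_display) (Omega : measurableType dO)
  (Zt : measurableType dZ) (R : realType).

Definition expect (P : probability Omega R) (X : Omega -> R) : R :=
  Rintegral P setT X.

Definition iid_sample (P : probability Omega R) (D : probability Zt R) (n : nat)
    (zs : 'I_n -> Omega -> Zt) : Prop :=
  (forall i, measurable_fun setT (zs i)) /\
  (forall i (A : set Zt), measurable A -> P (zs i @^-1` A) = D A) /\
  (forall A : 'I_n -> set Zt, (forall i, measurable (A i)) ->
     P (\bigcap_(i in [set: 'I_n]) (zs i @^-1` A i)) =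
     (\prod_(i < n) P (zs i @^-1` A i))%E).

End Prob.

(* Main.v *)
Require Import Defs.
From HB Require Import structures.
From mathcomp Require Import all_boot all_order all_algebra.
From mathcomp Require Import all_classical all_reals all_analysis.
From mathcomp Require Import perm measurable_realfun ring lra.
Import Order.TTheory GRing.Theory Num.Theory.
Import numFieldNormedType.Exports.
Local Open Scope ring_scope.
Local Open Scope classical_set_scope.
Set Implicit Arguments.
Unset Strict Implicit.
Unset Printing Implicit Defensive.

(* Replace-one stability. Add a ghost point z' to the sample and let S' be S with
   z_i replaced by z'. Exchangeability of (z', z_1, ..., z_n) turns the generalization
   gap into E[f(A(S'), z_i) - f(A(S), z_i)]. For a nonnegative convex smooth loss this
   difference is at most 2 beta l f(A(S), z_i) + (1 / (2 l) + beta) |A(S') - A(S)|^2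
   for every l > 0. The two trajectories share the gradient steps on the common
   points, and those steps are nonexpansive by cocoercivity, so
   n^2 |A(S') - A(S)|^2 <= (sum eta_t) sum eta_t |grad f(W_t, z_i) - grad f(W'_t, z')|^2,
   whose mean is at most 4 (sum eta_t) eps_path, again by exchangeability. Optimizing
   over l after taking expectations concludes. *)

(** * Smooth convex functions *)

(** The optimal weight is [l = sqrt b / sqrt a]. It degenerates when [a] or [b] vanishes; then a
    single well-chosen [l] refutes [0 < x]. *)
Lemma le_2sqrtM (R : realType) (x a b : R) : 0 <= a -> 0 <= b ->
  (forall l, 0 < l -> x <= l * a + l^-1 * b) -> x <= 2 * Num.sqrt (a * b).
Proof.
move=> a0 b0 H.
have [a_eq0|a_neq0] := eqVneq a 0.
  rewrite a_eq0 mul0r sqrtr0 mulr0 leNgt; apply/negP => x0.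
  (* With this weight [l^-1 * b] equals [x * b / (b + 1)], strictly below [x]; adding 1 keeps the
     witness positive when [b = 0]. *)
  have l0 : 0 < (b + 1) / x by rewrite divr_gt0//; lra.
  have := H _ l0; rewrite a_eq0 mulr0 add0r invf_div.
  have b1 : b + 1 != 0 by rewrite gt_eqF//; lra.
  rewrite mulrAC ler_pdivlMr; last lra.
  by nra.
have [b_eq0|b_neq0] := eqVneq b 0.
  rewrite b_eq0 mulr0 sqrtr0 mulr0 leNgt; apply/negP => x0.
  have l0 : 0 < x / (2 * a) by rewrite divr_gt0// mulr_gt0// lt_def a_neq0.
  have := H _ l0; rewrite b_eq0 mulr0 addr0 invfM !mulrA mulfVK// ; lra.
have a1 : 0 < Num.sqrt a by rewrite sqrtr_gt0 lt_def a_neq0.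
have b1 : 0 < Num.sqrt b by rewrite sqrtr_gt0 lt_def b_neq0.
have /H := divr_gt0 b1 a1.
rewrite -{2}(sqr_sqrtr a0) -{3}(sqr_sqrtr b0) sqrtrM// invf_div => /le_trans; apply.
by rewrite le_eqVlt; apply/orP; left; apply/eqP; field; rewrite !gt_eqF.
Qed.

(** Expand the sum of [(a j - m) ^+ 2], which is nonnegative. Dividing by the full count [n] in [m],
    not by the number of selected indices, is harmless because that number is at most [n]. *)
Lemma sqr_sum_le (R : realType) (n : nat) (p : pred 'I_n) (a : 'I_n -> R) :
  (\sum_(j | p j) a j) ^+ 2 <= n%:R * \sum_(j | p j) a j ^+ 2.
Proof.
case: n => [|n] in p a *.
  by rewrite !big_ord0 mulr0 expr0n.
set s := \sum_(j | p j) a j; set q := \sum_(j | p j) a j ^+ 2.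
pose m := s / n.+1%:R.
have : 0 <= \sum_(j | p j) (a j - m) ^+ 2 by apply: sumr_ge0 => j _; exact: sqr_ge0.
have -> : \sum_(j | p j) (a j - m) ^+ 2 = q - 2 * m * s + \sum_(j | p j) m ^+ 2.
  rewrite /q /s mulr_sumr -sumrB -big_split/=.
  by apply: eq_bigr => j _; ring.
have : \sum_(j | p j) m ^+ 2 <= n.+1%:R * m ^+ 2.
  rewrite sumr_const -[leLHS]mulr_natl ler_wpM2r ?sqr_ge0// ler_nat.
  by rewrite (leq_trans (max_card _))// card_ord.
have n0 : 0 < n.+1%:R :> R by rewrite ltr0n.
have -> : s = n.+1%:R * m by rewrite /m mulrCA divff ?mulr1 ?gt_eqF.
move: (n.+1%:R) n0 => N N0 h1 h2.
have : 0 <= N * (q - N * m ^+ 2) by apply: mulr_ge0; lra.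
by lra.
Qed.

(** * Euclidean inner product and squared norm *)

Section euclidean.
Variables (R : realType) (d : nat).
Implicit Types u v w : 'rV[R]_d.

Definition dotp u v : R := \sum_(j < d) u 0 j * v 0 j.

Lemma sqnorm2E v : sqnorm2 v = dotp v v.
Proof. by apply: eq_bigr => j _; rewrite expr2. Qed.

Lemma dotpC u v : dotp u v = dotp v u.
Proof. by apply: eq_bigr => j _; rewrite mulrC. Qed.

Lemma dotpDl u v w : dotp (u + v) w = dotp u w + dotp v w.
Proof. by rewrite -big_split; apply: eq_bigr => j _; rewrite mxE mulrDl. Qed.

Lemma dotpZl a u v : dotp (a *: u) v = a * dotp u v.
Proof. by rewrite mulr_sumr; apply: eq_bigr => j _; rewrite mxE mulrA. Qed.

Lemma dotpNl u v : dotp (- u) v = - dotp u v.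
Proof. by rewrite -scaleN1r dotpZl mulN1r. Qed.

Lemma dotpDr u v w : dotp w (u + v) = dotp w u + dotp w v.
Proof. by rewrite dotpC dotpDl !(dotpC w). Qed.

Lemma dotpZr a u v : dotp v (a *: u) = a * dotp v u.
Proof. by rewrite dotpC dotpZl dotpC. Qed.

Lemma dotpNr u v : dotp v (- u) = - dotp v u.
Proof. by rewrite dotpC dotpNl dotpC. Qed.

Definition dotpE := (dotpDl, dotpDr, dotpNl, dotpNr, dotpZl, dotpZr).

Lemma dotp_suml (I : finType) (p : pred I) (F : I -> 'rV[R]_d) v :
  dotp (\sum_(j | p j) F j) v = \sum_(j | p j) dotp (F j) v.
Proof.
rewrite exchange_big/=; apply: eq_bigr => j _.
by rewrite summxE mulr_suml.
Qed.

Lemma sqnorm2_ge0 v : 0 <= sqnorm2 v.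
Proof. by apply: sumr_ge0 => j _; exact: sqr_ge0. Qed.

Lemma sqnorm2_eq0 v : sqnorm2 v = 0 -> v = 0.
Proof.
move/eqP; rewrite psumr_eq0; last by move=> j _; exact: sqr_ge0.
move/allP => h; apply/rowP => j; rewrite mxE; apply/eqP.
by rewrite -sqrf_eq0; apply: h; rewrite mem_index_enum.
Qed.

Lemma sqnorm2D u v : sqnorm2 (u + v) = sqnorm2 u + 2 * dotp u v + sqnorm2 v.
Proof. by rewrite !sqnorm2E !dotpE (dotpC v u); ring. Qed.

Lemma sqnorm2Z a v : sqnorm2 (a *: v) = a ^+ 2 * sqnorm2 v.
Proof. by rewrite !sqnorm2E !dotpE; ring. Qed.

(** Expand the square of [l *: u - v] and divide by [l]. This weighted form replaces Cauchy-Schwarz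
    throughout and leaves [l] free for optimization. *)
Lemma dotp_young (l : R) u v : 0 < l ->
  2 * dotp u v <= l * sqnorm2 u + l^-1 * sqnorm2 v.
Proof.
move=> l0; have := sqnorm2_ge0 (l *: u - v).
rewrite sqnorm2D sqnorm2Z -scaleN1r sqnorm2Z !dotpE => h.
rewrite -subr_ge0 -(pmulr_rge0 _ l0).
rewrite [X in 0 <= X](_ : _ = l ^+ 2 * sqnorm2 u - 2 * l * dotp u v + sqnorm2 v); first lra.
by field; rewrite gt_eqF.
Qed.

Lemma sqnorm2B_le u v : sqnorm2 (u - v) <= 2 * (sqnorm2 u + sqnorm2 v).
Proof.
have := sqnorm2_ge0 (u + v).
by rewrite !sqnorm2D -scaleN1r sqnorm2Z !dotpE; lra.
Qed.

Lemma sqnorm2_sum (n : nat) (p : pred 'I_n) (F : 'I_n -> 'rV[R]_d) :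
  sqnorm2 (\sum_(j | p j) F j) <= n%:R * \sum_(j | p j) sqnorm2 (F j).
Proof.
rewrite [X in _ * X]exchange_big/= mulr_sumr; apply: ler_sum => k _.
by rewrite summxE sqr_sum_le.
Qed.

Lemma sqnorm2_norm2 v : sqnorm2 v = norm2 v ^+ 2.
Proof. by rewrite sqr_sqrtr// sqnorm2_ge0. Qed.

Section smooth_convex.
Variables (g : 'rV[R]_d -> R) (beta : R).
Hypotheses (beta0 : 0 < beta) (cg : convex_fun g) (sg : smooth beta g).

Lemma derive_grad w v : 'D_v g w = dotp (grad g w) v.
Proof.
have dg := sg.1 w.
rewrite deriveE// {1}(row_sum_delta v) linear_sum/=; apply: eq_bigr => j _.
by rewrite linearZ/= mxE mulrC deriveE.
Qed.

(** Convexity bounds the difference quotient from [u] towards [v] by [g v - g u] for every step [h]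
    in (0, 1]; the right limit at 0 is the directional derivative. *)
Lemma convex_grad_le u v : dotp (grad g u) (v - u) <= g v - g u.
Proof.
rewrite -derive_grad.
have dg : derivable g u (v - u) by apply: diff_derivable; exact: sg.1.
apply: (cvgr_to_le (cvg_dnbhs_at_right dg)); near=> h.
have h0 : 0 < h by near: h; exact: nbhs_right_gt.
have h1 : h <= 1 by near: h; exact: nbhs_right_le.
rewrite /= /GRing.scale/= ler_pdivrMl//.
have := @cg v u h; rewrite h1 (ltW h0) => /(_ isT).
have -> : h *: (v - u) + u = h *: v + (1 - h) *: u.
  by rewrite scalerBl scale1r scalerBr -addrA (addrC u).
by lra.
Unshelve. all: by end_near.
Qed.

Lemma smooth_sqnorm2 w u :
  sqnorm2 (grad g w - grad g u) <= beta ^+ 2 * sqnorm2 (w - u).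
Proof.
rewrite !sqnorm2_norm2 -exprMn lerXn2r// ?nnegrE ?mulr_ge0 ?sqrtr_ge0//.
  exact: ltW.
exact: sg.2.
Qed.

(** Young's inequality with weight [beta^-1] balances the two squares, each being at most
    [beta * sqnorm2 (w - u)]. *)
Lemma smooth_dotp w u :
  dotp (grad g w - grad g u) (w - u) <= beta * sqnorm2 (w - u).
Proof.
have b0 : 0 < beta^-1 by rewrite invr_gt0.
have := dotp_young (grad g w - grad g u) (w - u) b0.
have := smooth_sqnorm2 w u.
rewrite invrK => /(ler_wpM2l (ltW b0)).
by rewrite mulrA expr2 mulKf ?gt_eqF//; lra.
Qed.

(* The integral remainder would give [beta / 2]; convexity gives [beta] without
   integration. *)
Lemma smooth_upper w u :
  g w <= g u + dotp (grad g u) (w - u) + beta * sqnorm2 (w - u).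
Proof.
have := convex_grad_le w u; have := smooth_dotp w u.
by rewrite -[u - w]opprB !dotpE; lra.
Qed.

(** Evaluate [g] at [v], a step from [w] along the gradient difference: the tangent at [u] bounds
    [g v] from below, smoothness at [w] from above. The step length [1 / (2 beta)] is optimal for
    the constant [beta] of [smooth_upper]. *)
Lemma cocoercive_half w u :
  sqnorm2 (grad g w - grad g u) <=
  4 * beta * (g w - g u - dotp (grad g u) (w - u)).
Proof.
have [h hE] : exists h, h = grad g w - grad g u by eexists.
rewrite -hE; pose v := w - (2 * beta)^-1 *: h.
have := convex_grad_le u v; have := smooth_upper v w.
have -> : v - u = (w - u) - (2 * beta)^-1 *: h by rewrite /v addrAC.
have -> : v - w = - ((2 * beta)^-1 *: h) by rewrite /v addrAC subrr add0r.
rewrite -scaleNr sqnorm2Z => h1 h2.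
have hh : dotp (grad g w) h = dotp (grad g u) h + sqnorm2 h.
  by rewrite sqnorm2E {3}hE !dotpE; lra.
have : (4 * beta)^-1 * sqnorm2 h <= g w - g u - dotp (grad g u) (w - u).
  move: h1 h2; rewrite !dotpE hh.
  set k := dotp _ h; set q := sqnorm2 h.
  have -> : beta * ((- (2 * beta)^-1) ^+ 2 * q) = (4 * beta)^-1 * q.
    by field; rewrite gt_eqF.
  have -> : (2 * beta)^-1 = 2 * (4 * beta)^-1 by field; rewrite gt_eqF.
  by lra.
by rewrite mulrC ler_pdivrMr 1?mulrC// mulr_gt0.
Qed.

(** Adding [cocoercive_half] to its copy with [w] and [u] exchanged cancels the function values. *)
Lemma cocoercive w u :
  sqnorm2 (grad g w - grad g u) <=
  2 * beta * dotp (grad g w - grad g u) (w - u).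
Proof.
have := cocoercive_half w u; have := cocoercive_half u w.
rewrite -[grad g u - _]opprB -scaleN1r sqnorm2Z.
rewrite -[u - w]opprB !dotpE.
set a := g w; set b := g u; set p := dotp _ _; set q := dotp (grad g w) u.
set r := dotp _ w; set t := dotp _ _ ; set k := sqnorm2 _.
by lra.
Qed.

(** A gradient step of length [1 / (2 beta)] decreases [g] by at least
    [sqnorm2 (grad g w) / (4 beta)], yet the value reached is still nonnegative. *)
Lemma self_bounding w : (forall v, 0 <= g v) ->
  sqnorm2 (grad g w) <= 4 * beta * g w.
Proof.
move=> g0.
have := smooth_upper (w - (2 * beta)^-1 *: grad g w) w.
have := g0 (w - (2 * beta)^-1 *: grad g w).
have -> : w - (2 * beta)^-1 *: grad g w - w = - ((2 * beta)^-1 *: grad g w).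
  by rewrite addrAC subrr add0r.
rewrite -scaleNr sqnorm2Z dotpZr -sqnorm2E.
set q := sqnorm2 _ => h1 h2.
have : (4 * beta)^-1 * q <= g w.
  apply: le_trans (_ : (2 * beta)^-1 * q - beta * ((- (2 * beta)^-1) ^+ 2 * q) <= _).
    by rewrite le_eqVlt; apply/orP; left; apply/eqP; field; rewrite gt_eqF.
  by lra.
by rewrite mulrC ler_pdivrMr 1?mulrC// mulr_gt0.
Qed.

(** The difference lies between the tangent at [u] and the smooth upper bound there. Young's
    inequality for both signs of the gradient, then self-bounding, leaves only the loss at [u],
    whose mean will be the empirical risk of the output. *)
Lemma loss_diff_le w u l : (forall v, 0 <= g v) -> 0 < l ->
  `|g w - g u| <= 2 * beta * l * g u + (l^-1 / 2 + beta) * sqnorm2 (w - u).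
Proof.
move=> g0 l0.
have h1 := convex_grad_le u w.
have h2 := smooth_upper w u.
have h3 := dotp_young (grad g u) (w - u) l0.
have h4 := dotp_young (- grad g u) (w - u) l0.
have h5 : l * sqnorm2 (grad g u) <= l * (4 * beta * g u).
  by rewrite ler_pM2l// self_bounding.
have h6 : 0 <= beta * sqnorm2 (w - u) by rewrite mulr_ge0 ?sqnorm2_ge0// ltW.
move: h4; rewrite -scaleN1r sqnorm2Z dotpZl => h4.
by rewrite ler_norml; apply/andP; split; lra.
Qed.

End smooth_convex.

End euclidean.

(** * Stability of gradient descent *)

Section stability.
Variables (R : realType) (d : nat).

(** In the expanded square, the quadratic term is at most [(e / n)] times the sum of the
    [dotp (h j) x], by cocoercivity and [2 * beta * e <= 1], while the cross term subtracts twice as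
    much. *)
Lemma nonexpansive_step (n : nat) (p : pred 'I_n) (h : 'I_n -> 'rV[R]_d)
    (x : 'rV[R]_d) (beta e : R) :
  0 < beta -> 0 <= e <= (2 * beta)^-1 ->
  (forall j, sqnorm2 (h j) <= 2 * beta * dotp (h j) x) ->
  sqnorm2 (x - (e / n%:R) *: \sum_(j | p j) h j) <= sqnorm2 x.
Proof.
move=> b0 /andP[e0 eb] hx.
rewrite -scaleNr sqnorm2D sqnorm2Z dotpZr dotpC dotp_suml.
have := sqnorm2_sum p h.
have : \sum_(j | p j) sqnorm2 (h j) <= 2 * beta * \sum_(j | p j) dotp (h j) x.
  by rewrite mulr_sumr; apply: ler_sum => j _; exact: hx.
have : 0 <= \sum_(j | p j) sqnorm2 (h j).
  by apply: sumr_ge0 => j _; exact: sqnorm2_ge0.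
set q := \sum_(j | p j) sqnorm2 (h j); set D := \sum_(j | p j) dotp (h j) x.
set s := sqnorm2 (\sum_(j | p j) _) => q0 qD sq.
(* For [n = 0] the inverse is 0 by convention and the step is void. *)
have [n0|n0] := eqVneq (n%:R : R) 0.
  by rewrite n0 invr0 mulr0 oppr0 expr0n/=; lra.
have n1 : 0 < n%:R :> R by rewrite lt_def n0 ler0n.
have eb' : e * (2 * beta) <= 1 by rewrite -ler_pdivlMr ?mulr_gt0// mul1r.
have D0 : 0 <= D by move: (le_trans q0 qD); rewrite pmulr_rge0// mulr_gt0.
have k0 : 0 <= e / n%:R by rewrite divr_ge0// ler0n.
have h1 : (e / n%:R) ^+ 2 * s <= (e / n%:R) ^+ 2 * (n%:R * q).
  by rewrite ler_wpM2l// sqr_ge0.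
have h2 : (e / n%:R) ^+ 2 * (n%:R * q) = (e / n%:R) * (e * q) by field.
have h3 : e * q <= D.
  apply: le_trans (ler_wpM2l e0 qD) _.
  by rewrite mulrA; apply: ler_piMl.
have h4 : (e / n%:R) * (e * q) <= (e / n%:R) * D by rewrite ler_wpM2l.
have h5 : 0 <= (e / n%:R) * D by rewrite mulr_ge0.
by rewrite sqrrN; lra.
Qed.

(* Weighted Cauchy-Schwarz, one summand at a time. *)
Lemma sqnorm2_step (x y : 'rV[R]_d) (H C e : R) :
  0 <= H -> 0 <= C -> 0 <= e -> sqnorm2 x <= H * C ->
  sqnorm2 (x + e *: y) <= (H + e) * (C + e * sqnorm2 y).
Proof.
move=> H0 C0 e0 xHC; have y0 := sqnorm2_ge0 y.
have [HE|HN] := eqVneq H 0.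
  have -> : x = 0.
    by apply: sqnorm2_eq0; apply/eqP; rewrite eq_le sqnorm2_ge0 andbT; move: xHC; rewrite HE mul0r.
  by rewrite add0r sqnorm2Z HE; nra.
have Hp : 0 < H by rewrite lt_def HN.
have Hi : 0 < H^-1 by rewrite invr_gt0.
(* The weight [H^-1] turns [sqnorm2 x <= H * C] into a contribution of at most [C], and leaves
   [H * sqnorm2 y] from the other square. *)
have := dotp_young x y Hi; rewrite invrK => /(ler_wpM2l e0) h1.
have h2 : e * (H^-1 * sqnorm2 x) <= e * C.
  by rewrite ler_wpM2l// mulrC ler_pdivrMr// mulrC.
by rewrite sqnorm2D sqnorm2Z dotpZr; lra.
Qed.

Variables (Z : Type) (n : nat) (f : 'rV[R]_d -> Z -> R) (beta : R).
Variables (eta : nat -> R) (W1 : 'rV[R]_d).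
Hypothesis beta0 : 0 < beta.
Hypothesis cf : forall z, convex_fun (f^~ z).
Hypothesis sf : forall z, smooth beta (f^~ z).

(** Induction on [k]: the part of the update over [j != i] contracts the current difference, and the
    [i]-th summand adds a perturbation of size [eta / n]. Scaling by [n] makes [sqnorm2_step]
    accumulate both sums. Since [gd_iter] counts from 0, the iterate W_t sits at index [t.-1]. *)
Lemma gd_iter_stable (s s' : 'I_n -> Z) (i : 'I_n) (k : nat) :
  (forall j, j != i -> s' j = s j) ->
  (forall t, (1 <= t <= k)%N -> 0 <= eta t <= (2 * beta)^-1) ->
  n%:R ^+ 2 * sqnorm2 (gd_iter f eta W1 s k - gd_iter f eta W1 s' k) <=
  (\sum_(1 <= t < k.+1) eta t) *
  \sum_(1 <= t < k.+1) eta t *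
    sqnorm2 (grad (f^~ (s i)) (gd_iter f eta W1 s t.-1) -
             grad (f^~ (s' i)) (gd_iter f eta W1 s' t.-1)).
Proof.
move=> ss'; rewrite -sqnorm2Z; elim: k => [|k IHk] etab.
  by rewrite !big_geq// mulr0 subrr scaler0 sqnorm2E -(scale0r (W1)) dotpZl mul0r.
have etab' t : (1 <= t < k.+1)%N -> 0 <= eta t <= (2 * beta)^-1.
  by move=> /andP[t1 tk]; apply: etab; rewrite t1 ltnW.
(* The index [i] inhabits ['I_n], so [n] is positive. *)
have n1 : n%:R != 0 :> R by rewrite pnatr_eq0 -lt0n; case: n i {ss' s s' IHk} => [[]|].
rewrite ![\sum_(1 <= t < k.+2) _]big_nat_recr//=.
set W := gd_iter f eta W1 s k in IHk *; set W' := gd_iter f eta W1 s' k in IHk *.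
set e := eta k.+1.
(* [x] is the difference after updating with the common points only; [y] carries the discrepancy at
   index [i]. *)
pose x := (W - W') - (e / n%:R) *:
  \sum_(j | j != i) (grad (f^~ (s j)) W - grad (f^~ (s j)) W').
set y := grad (f^~ (s i)) W - grad (f^~ (s' i)) W'.
have -> : n%:R *: (W - (e / n%:R) *: \sum_(j < n) grad (f^~ (s j)) W -
    (W' - (e / n%:R) *: \sum_(j < n) grad (f^~ (s' j)) W')) =
    n%:R *: x + e *: (- y).
  rewrite /x (bigD1 i)//= [in X in _ - X](bigD1 i)//=.
  rewrite (eq_bigr (fun j => grad (f^~ (s j)) W') (F1 := fun j => grad (f^~ (s' j)) W')); last first.
    by move=> j /ss' ->.
  rewrite sumrB; set a := \sum_(j | _) _; set b := \sum_(j | _) _.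
  apply/rowP => l; rewrite /y !mxE.
  by field.
have e0 : 0 <= e <= (2 * beta)^-1 by apply: etab; rewrite leqnn.
have y2 : sqnorm2 (- y) = sqnorm2 y by rewrite -scaleN1r sqnorm2Z sqrrN expr1n mul1r.
rewrite -y2; apply: sqnorm2_step.
- by rewrite big_nat; apply: sumr_ge0 => t /etab' /andP[].
- rewrite big_nat; apply: sumr_ge0 => t /etab' /andP[t0 _].
  by rewrite mulr_ge0// sqnorm2_ge0.
- by case/andP: e0.
- apply: le_trans (IHk etab').
  rewrite !sqnorm2Z ler_wpM2l ?sqr_ge0//.
  apply: (@nonexpansive_step _ _ (fun j => grad (f^~ (s j)) W - grad (f^~ (s j)) W') _ _ _ beta0 e0) => j.
  exact: cocoercive.
Qed.
End stability.

(** * Measurability of the iterates *)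

Section measurable_rv.
Context (R : realType) (d : nat) (dX : measure_display) (X : measurableType dX).

(** The preimage of [B] splits into countably many measurable pieces, one for each value of [c]. *)
Lemma measurable_fun_countable_param (I : countType) dY (Y : measurableType dY)
    (c : X -> I) (h : I -> X -> Y) :
  (forall q, measurable (c @^-1` [set q])) ->
  (forall q, measurable_fun setT (h q)) ->
  measurable_fun setT (fun x => h (c x) x).
Proof.
move=> mc mh _ B mB; rewrite setTI.
rewrite (_ : _ @^-1` B = \bigcup_q (c @^-1` [set q] `&` h q @^-1` B)).
  apply: countable_bigcupT_measurable; first exact: countableP.
  by move=> q; apply: measurableI => //; rewrite -[X in measurable X]setTI; exact: mh.
by apply/seteqP; split => [x/= hx|x/= [q _ [/= <-]]//]; exists (c x).
Qed.

(** Coordinatewise, so that no sigma-algebra on row vectors has to be fixed. *)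
Definition measurable_rv (W : X -> 'rV[R]_d) :=
  forall j, measurable_fun setT (fun x => W x 0 j).

(* Rounding to a grid makes [W] countably valued, so that joint measurability reduces
   to measurability at fixed [w]; continuity in [w] passes to the limit. *)
Definition grid (k : nat) (v : 'rV[R]_d) : 'rV[int]_d :=
  \row_j Num.floor (v 0 j * k.+1%:R).

Definition ungrid (k : nat) (q : 'rV[int]_d) : 'rV[R]_d :=
  \row_j ((q 0 j)%:~R / k.+1%:R).

Lemma cvg_grid (v : 'rV[R]_d) : ungrid k (grid k v) @[k --> \oo] --> v.
Proof.
apply/cvgrPdist_le => e e0; near=> k.
rewrite [leLHS]/Num.norm/= mx_normrE.
apply/bigmax_leP; split => [|[i j] _]; first exact: ltW.
rewrite !mxE ord1/=.
have k0 : 0 < k.+1%:R :> R by [].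
set y := v 0 j.
have /andP[h1 h2] := floor_itv (y * k.+1%:R).
have -> : y - (Num.floor (y * k.+1%:R))%:~R / k.+1%:R =
    (y * k.+1%:R - (Num.floor (y * k.+1%:R))%:~R) / k.+1%:R.
  by rewrite mulrBl mulfK// gt_eqF.
rewrite ger0_norm; last by rewrite divr_ge0// subr_ge0.
apply: (@le_trans _ _ (k.+1%:R^-1)).
  by rewrite ler_pdivrMr// mulVf ?gt_eqF//; move: h2; rewrite intrD; lra.
by apply: ltW; near: k; exact: (near_infty_natSinv_lt (PosNum e0)).
Unshelve. all: by end_near.
Qed.

(** A fibre of the rounding map is a box of half-open intervals, one for each coordinate. *)
Lemma measurable_grid k W q : measurable_rv W -> measurable ((grid k \o W) @^-1` [set q]).
Proof.
move=> mW.
rewrite (_ : _ @^-1` _ = \bigcap_(j in [set: 'I_d])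
    ((fun x => W x 0 j * k.+1%:R) @^-1` `[(q 0 j)%:~R, (q 0 j + 1)%:~R[%classic)).
  apply: fin_bigcap_measurable => // j _.
  rewrite -[X in measurable X]setTI; apply: measurable_funM => //.
apply/seteqP; split => [x /= <- j _|x /= h].
  by rewrite /= mxE in_itv/=; apply/floor_itv.
apply/rowP => j; rewrite mxE; apply/eqP; by rewrite floor_eq; have := h j I; rewrite /= in_itv/=.
Qed.

Lemma measurable_caratheodory (Z : Type) (g : 'rV[R]_d -> Z -> R)
   (W : X -> 'rV[R]_d) (zeta : X -> Z) :
  (forall z, continuous (g^~ z)) ->
  (forall w, measurable_fun setT (fun x => g w (zeta x))) ->
  measurable_rv W -> measurable_fun setT (fun x => g (W x) (zeta x)).
Proof.
move=> cg mg mW.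
apply: (@measurable_fun_cvg _ _ _ _ (fun k x => g (ungrid k (grid k (W x))) (zeta x))).
  move=> k; apply: (measurable_fun_countable_param (c := grid k \o W)
    (h := fun q x => g (ungrid k q) (zeta x))) => q; last exact: mg.
  exact: measurable_grid.
move=> x _; exact: cvg_comp (@cvg_grid (W x)) (cg (zeta x) (W x)).
Qed.

(** Each partial derivative is the limit of difference quotients along the sequence [harmonic], and
    each quotient is measurable by [measurable_caratheodory]. *)
Lemma measurable_grad (Z : Type) (f : 'rV[R]_d -> Z -> R)
   (W : X -> 'rV[R]_d) (zeta : X -> Z) :
  (forall z w, differentiable (f^~ z) w) ->
  (forall w, measurable_fun setT (fun x => f w (zeta x))) ->
  measurable_rv W -> measurable_rv (fun x => grad (f^~ (zeta x)) (W x)).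
Proof.
move=> df mf mW j.
pose t k : R := (harmonic k).
apply: (@measurable_fun_cvg _ _ _ _ (fun k x => (t k)^-1 *
  (f (t k *: delta_mx 0 j + W x) (zeta x) - f (W x) (zeta x)))) => [k|x _].
  have cf z : continuous (f^~ z) by move=> w; exact: differentiable_continuous.
  apply: measurable_funM => //; apply: measurable_funB; apply: measurable_caratheodory => //.
  by move=> l; under eq_fun do rewrite !mxE; exact: measurable_funD.
rewrite mxE.
have dg : derivable (f^~ (zeta x)) (W x) (delta_mx 0 j) by apply: diff_derivable.
have /cvgr_dnbhsP := dg; apply; split=> [k|]; last exact: cvg_harmonic.
by rewrite gt_eqF// harmonic_gt0.
Qed.

Lemma measurable_sqnorm2 W : measurable_rv W -> measurable_fun setT (fun x => sqnorm2 (W x)).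
Proof.
by move=> mW; apply: measurable_sum => j; apply: measurable_funX.
Qed.

Lemma measurable_gd_iter (n : nat) (Z : Type) (f : 'rV[R]_d -> Z -> R) eta W1
   (zeta : X -> 'I_n -> Z) k :
  (forall z w, differentiable (f^~ z) w) ->
  (forall w j, measurable_fun setT (fun x => f w (zeta x j))) ->
  measurable_rv (fun x => gd_iter f eta W1 (zeta x) k).
Proof.
move=> df mf; elim: k => [|k IHk] j/=; first exact: measurable_cst.
under eq_fun do rewrite !mxE summxE.
apply: measurable_funB => //; apply: measurable_funM => //.
apply: measurable_sum => l.
exact: (measurable_grad (zeta := zeta^~ l)).
Qed.

End measurable_rv.

(** * I.i.d. samples and the ghost point *)

Section iid.
Context (R : realType) (dZ : measure_display) (Z : measurableType dZ) (n : nat).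

Definition rect (A : 'I_n -> set Z) : set (n.-tuple Z) := [set t | forall j, A j (tnth t j)].
Definition rects : set_system (n.-tuple Z) :=
  [set rect A | A in [set A | forall j, measurable (A j)]].

Lemma measurable_rect A : (forall j, measurable (A j)) -> measurable (rect A).
Proof.
move=> mA; rewrite (_ : rect A = \bigcap_(j in [set: 'I_n]) ((@tnth n Z)^~ j @^-1` A j)).
  apply: fin_bigcap_measurable => // j _.
  by rewrite -[X in measurable X]setTI; exact: measurable_tnth.
by apply/seteqP; split => [t h j _|t h j]; [exact: h|exact: h].
Qed.

(** A coordinate preimage is a rectangle whose other sides are full. Together with stability under
    intersection, this lets a finite measure on tuples be identified by its values on rectangles. *)
Lemma measurable_tupleE : @measurable _ (n.-tuple Z) = <<s rects >>.
Proof.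
apply/seteqP; split; last first.
  apply: smallest_sub; first exact: sigma_algebra_measurable.
  by move=> _ [A mA <-]; exact: measurable_rect.
apply: smallest_sub; first exact: smallest_sigma_algebra.
move=> B; rewrite -bigcup_seq => -[i _ [A mA <-]]; apply: sub_sigma_algebra.
exists (fun j => if j == i then A else setT); first by move=> j/=; case: ifP.
rewrite setTI; apply/seteqP; split=> [t /(_ i)|t h j]; first by rewrite eqxx.
by case: eqP => [->|].
Qed.

Lemma setI_closed_rects : setI_closed rects.
Proof.
move=> _ _ [A mA <-] [B mB <-]; exists (fun j => A j `&` B j).
  by move=> j /=; exact: measurableI.
apply/seteqP; split=> [t h|t [hA hB] j]; last by split; [exact: hA|exact: hB].
by split=> j; have [] := h j.
Qed.

Definition sample_tuple (X : Type) (zs : 'I_n -> X -> Z) (x : X) : n.-tuple Z :=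
  [tuple zs j x | j < n].

Lemma measurable_sample_tuple dX (X : measurableType dX) (zs : 'I_n -> X -> Z) :
  (forall j, measurable_fun setT (zs j)) -> measurable_fun setT (sample_tuple zs).
Proof.
move=> mz; apply/measurable_fun_tnthP => j.
by rewrite (_ : _ \o _ = zs j)//; apply/funext => x; rewrite /= tnth_mktuple.
Qed.

Context (d1 d2 : measure_display) (X1 : measurableType d1) (X2 : measurableType d2).

(** Independence gives both sample laws the same product value on rectangles, so the laws coincide
    and the integral depends on [D] alone, not on the underlying space. *)
Lemma ge0_integral_iid (D : probability Z R)
    (P1 : probability X1 R) (z1 : 'I_n -> X1 -> Z)
    (P2 : probability X2 R) (z2 : 'I_n -> X2 -> Z) (h : n.-tuple Z -> \bar R) :
  iid_sample P1 D z1 -> iid_sample P2 D z2 ->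
  measurable_fun setT h -> (forall t, (0 <= h t)%E) ->
  (\int[P1]_x h (sample_tuple z1 x) = \int[P2]_x h (sample_tuple z2 x))%E.
Proof.
move=> [m1 [l1 i1]] [m2 [l2 i2]] mh h0.
pose Y1 : {mfun X1 >-> n.-tuple Z} := HB.pack (sample_tuple z1)
  (isMeasurableFun.Build _ _ _ _ _ (measurable_sample_tuple m1)).
pose Y2 : {mfun X2 >-> n.-tuple Z} := HB.pack (sample_tuple z2)
  (isMeasurableFun.Build _ _ _ _ _ (measurable_sample_tuple m2)).
rewrite -(ge0_integral_distribution Y1)// -(ge0_integral_distribution Y2)//.
apply: eq_measure_integral => B mB _.
apply: (measure_unique rects (fun=> setT)) => //.
- exact: measurable_tupleE.
- exact: setI_closed_rects.
- move=> _; exists (fun=> setT); first by move=> j; exact: measurableT.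
  by apply/seteqP; split.
- exact: bigcup_const.
- move=> _ [A mA <-]; 
  have E (X : Type) (z : 'I_n -> X -> Z) :
      sample_tuple z @^-1` rect A = \bigcap_(i in [set: 'I_n]) (z i @^-1` A i).
    by apply/seteqP; split => [x hx j _|x hx j]; have := hx j; rewrite /= tnth_mktuple//; exact.
  rewrite [LHS](_ : _ = P1 (sample_tuple z1 @^-1` rect A))//.
  rewrite [RHS](_ : _ = P2 (sample_tuple z2 @^-1` rect A))//.
  rewrite !E i1// i2//; apply: eq_bigr => j _.
  by rewrite l1// l2.
- by move=> _; apply: le_lt_trans (probability_le1 _ measurableT) _; rewrite ltry.
Qed.
End iid.

Section exchange.
Context (R : realType) (dZ dX : measure_display) (Z : measurableType dZ)
  (X : measurableType dX) (D : probability Z R) (P : probability X R) (n : nat)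
  (zs : 'I_n -> X -> Z).

Lemma iid_sample_inj (m : nat) (s : 'I_m -> 'I_n) :
  injective s -> iid_sample P D zs -> iid_sample P D (fun j => zs (s j)).
Proof.
move=> sI [mz [lz iz]]; split; [by move=> j|split; [by move=> j; exact: lz|move=> A mA]].
(* The constraints are carried along [s] and padded with the full set outside its image, where the
   factors are 1. *)
pose B i : set Z := if [pick j | s j == i] is Some j then A j else setT.
have Bs j : B (s j) = A j.
  by rewrite /B; case: pickP => [k /eqP /sI ->//|/(_ j)]; rewrite eqxx.
have mB i : measurable (B i) by rewrite /B; case: pickP.
rewrite (_ : \bigcap_(i in _) _ = \bigcap_(i in [set: 'I_n]) (zs i @^-1` B i)).
  rewrite iz//.
  rewrite (bigID [in [set s j | j : 'I_m]])/= [X in (_ * X)%E]big1 ?mule1; last first.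
    move=> i ic; rewrite /B; case: pickP => [j /eqP ji|_].
      by rewrite -ji imset_f in ic.
    by rewrite preimage_setT probability_setT.
  rewrite big_imset/=; last by move=> j k _ _ /sI.
  by apply: eq_bigr => j _; rewrite Bs.
apply/seteqP; split=> x h i _; last by have := h (s i) I; rewrite /= Bs.
rewrite /B/=; case: pickP => // j /eqP <-; exact: h.
Qed.

Let Q : probability (X * Z)%type R := (P \x D)%E.

Let probability_prodE (A : set X) (B : set Z) : measurable A -> measurable B ->
  Q (A `*` B) = (P A * D B)%E.
Proof. exact: product_measure1E. Qed.

(* Index [ord0] is the ghost point; index [lift ord0 j] is the j-th sample point. *)
Definition with_ghost (j : 'I_n.+1) (x : X * Z) : Z :=
  oapp (zs^~ x.1) x.2 (unlift ord0 j).

Lemma iid_with_ghost : iid_sample P D zs -> iid_sample (P \x D)%E D with_ghost.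
Proof.
rewrite -/Q => -[mz [lz iz]].
have mg : forall j, measurable_fun setT (with_ghost j).
  move=> j; rewrite /with_ghost; case: unliftP => [k _|_] /=.
    exact: measurableT_comp.
  exact: measurable_snd.
have lg : forall i A, measurable A -> Q (with_ghost i @^-1` A) = D A.
  move=> i A mA; rewrite /with_ghost; case: unliftP => [k _|_] /=.
    rewrite (_ : _ @^-1` _ = (zs k @^-1` A) `*` setT); last first.
      by apply/seteqP; split=> [x|x []].
    rewrite probability_prodE//; last by rewrite -[X in measurable X]setTI; exact: mz.
    by rewrite probability_setT mule1 lz.
  rewrite (_ : _ @^-1` _ = setT `*` A); last by apply/seteqP; split=> [x|x []].
  by rewrite probability_prodE// probability_setT mul1e.
split=> //; split=> // A mA.
rewrite (_ : \bigcap_(i in _) _ =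
    (\bigcap_(i in [set: 'I_n]) (zs i @^-1` A (lift ord0 i))) `*` A ord0).
  rewrite probability_prodE//; last first.
    apply: fin_bigcap_measurable => // i _.
    by rewrite -[X in measurable X]setTI; exact: mz.
  rewrite iz// big_ord_recl lg// muleC; congr (_ * _)%E.
  by apply: eq_bigr => j _; rewrite lg// lz.
apply/seteqP; split => [x h|x [h1 h2] j _].
  split; last by have := h ord0 I; rewrite /with_ghost/= unlift_none.
  by move=> j _; have := h (lift ord0 j) I; rewrite /with_ghost/= liftK.
rewrite /with_ghost/=; case: unliftP => [k|] -> //=; exact: h1.
Qed.

End exchange.

(** * Integrable functions with a given mean *)

Section has_mean.
Context (R : realType) (d : measure_display) (X : measurableType d)
  (mu : probability X R).
Implicit Types (h g : X -> R) (m k : R).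

(** Pairing integrability with the value lets linear combinations propagate both at once. *)
Definition has_mean h m :=
  mu.-integrable setT (EFin \o h) /\ Rintegral mu setT h = m.

Lemma integrable_has_mean h :
  mu.-integrable setT (EFin \o h) -> has_mean h (expect mu h).
Proof. by []. Qed.

Lemma has_mean_integral h m : has_mean h m -> (\int[mu]_x (h x)%:E)%E = m%:E.
Proof. by case=> ih <-; rewrite fineK//; exact: integrable_fin_num. Qed.

Lemma ge0_has_mean h m : measurable_fun setT h -> (forall x, 0 <= h x) ->
  (\int[mu]_x (h x)%:E)%E = m%:E -> has_mean h m.
Proof.
move=> mh h0 hm; split; last by rewrite /Rintegral hm.
apply/integrableP; split; first exact/measurable_EFinP.
by under eq_integral => x _ do rewrite /= ger0_norm//; rewrite hm ltry.
Qed.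

Lemma has_meanD h g m k : has_mean h m -> has_mean g k ->
  has_mean (fun x => h x + g x) (m + k).
Proof.
move=> [ih <-] [ig <-]; split; last by rewrite RintegralD.
exact: (integrableD measurableT ih ig).
Qed.

Lemma has_meanZ c h m : has_mean h m -> has_mean (fun x => c * h x) (c * m).
Proof.
move=> [ih <-]; split; last by rewrite RintegralZl.
exact: (integrableZl measurableT c ih).
Qed.

Lemma has_meanB h g m k : has_mean h m -> has_mean g k ->
  has_mean (fun x => h x - g x) (m - k).
Proof.
move=> hm /(has_meanZ (-1)) /(has_meanD hm).
by under eq_fun do rewrite mulN1r; rewrite mulN1r.
Qed.

Lemma has_mean0 : has_mean (fun=> 0) 0.
Proof. by split; [exact: integrable0|rewrite Rintegral_cst// mul0r]. Qed.

Lemma has_mean_sum (I : Type) (s : seq I) (p : pred I) (h : I -> X -> R)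
    (m : I -> R) : (forall i, p i -> has_mean (h i) (m i)) ->
  has_mean (fun x => \sum_(i <- s | p i) h i x) (\sum_(i <- s | p i) m i).
Proof.
move=> hm; elim: s => [|i s IHs].
  by rewrite big_nil; under eq_fun do rewrite big_nil; exact: has_mean0.
rewrite big_cons; under eq_fun do rewrite big_cons.
by case: ifP => // /hm hi; exact: has_meanD.
Qed.

Lemma has_mean_norm_le h g m k : has_mean h m -> has_mean g k ->
  (forall x, `|h x| <= g x) -> `|m| <= k.
Proof.
move=> [ih <-] [ig <-] hg; apply: le_trans (le_normr_Rintegral _ ih) _ => //.
apply: le_Rintegral => //; exact: (integrable_abse ih).
Qed.

Lemma has_mean_ge0 h m : (forall x, 0 <= h x) -> has_mean h m -> 0 <= m.
Proof. by move=> h0 [_ <-]; exact: Rintegral_ge0. Qed.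

End has_mean.

(** * Exchangeable law of the sample extended by a ghost point *)

Section ghost.
Context (R : realType) (dZ dX : measure_display) (Z : measurableType dZ)
  (X : measurableType dX) (D : probability Z R) (P : probability X R) (n : nat)
  (zs : 'I_n -> X -> Z).

Definition permute_tuple (m : nat) (s : 'I_m -> 'I_m) (t : m.-tuple Z) : m.-tuple Z :=
  [tuple tnth t (s j) | j < m].

Lemma measurable_permute_tuple (m : nat) (s : 'I_m -> 'I_m) :
  measurable_fun setT (permute_tuple s).
Proof.
apply/measurable_fun_tnthP => j.
rewrite (_ : _ \o _ = (@tnth _ Z)^~ (s j)); first exact: measurable_tnth.
by apply/funext => t; rewrite /= tnth_mktuple.
Qed.

Lemma sample_tuple_with_ghost o z :
  sample_tuple (with_ghost zs) (o, z) = [tuple of z :: sample_tuple zs o].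
Proof.
apply: eq_from_tnth => j; rewrite tnth_mktuple /with_ghost.
by case: unliftP => [k|] ->; rewrite ?tnthS ?tnth_mktuple ?tnth0.
Qed.

(** [mu] is the law of (z', z_1, ..., z_n) under the product of [P] and [D]. A permuted i.i.d.
    family is again i.i.d., which gives the invariance; Tonelli integrates out the ghost point.
    Nonnegativity spares integrability conditions in both. *)
Lemma exchangeable_extension : iid_sample P D zs ->
  exists mu : probability (n.+1.-tuple Z) R,
  (forall (h : n.+1.-tuple Z -> \bar R) s, injective s ->
    measurable_fun setT h -> (forall t, 0 <= h t)%E ->
    (\int[mu]_t h (permute_tuple s t) = \int[mu]_t h t)%E) /\
  (forall (h : n.+1.-tuple Z -> \bar R),
    measurable_fun setT h -> (forall t, 0 <= h t)%E ->
    (\int[mu]_t h t = \int[P]_o \int[D]_z h [tuple of z :: sample_tuple zs o])%E).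
Proof.
move=> iid; have iidg := iid_with_ghost iid.
pose Y : {mfun (X * Z)%type >-> n.+1.-tuple Z} :=
  HB.pack (sample_tuple (with_ghost zs))
  (isMeasurableFun.Build _ _ _ _ _ (measurable_sample_tuple iidg.1)).
exists (distribution (P \x D)%E Y); split=> [h s sI mh h0|h mh h0].
  have mhs : measurable_fun setT (h \o permute_tuple s) by
    apply: measurableT_comp mh _; exact: measurable_permute_tuple.
  have hs0 t : (0 <= (h \o permute_tuple s) t)%E by exact: h0.
  rewrite (ge0_integral_distribution Y mhs hs0).
  rewrite (ge0_integral_distribution Y)//.
  apply: (etrans _ (ge0_integral_iid (iid_sample_inj sI iidg) iidg mh h0)).
  apply: eq_integral => x _ /=; congr h; apply: eq_from_tnth => j.
  by rewrite !tnth_mktuple.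
have mhY : measurable_fun setT (h \o Y) by exact: measurableT_comp.
have hY0 x : (0 <= (h \o Y) x)%E by exact: h0.
rewrite (ge0_integral_distribution Y)// (fubini_tonelli1 _ mhY hY0).
apply: eq_integral => o _; apply: eq_integral => z _.
by rewrite -sample_tuple_with_ghost.
Qed.
End ghost.

(** * The generalization gap *)

(** Every full-batch update is a sum over the whole sample, hence blind to its order. *)
Lemma gd_iter_perm (R : realType) (d n : nat) (Z : Type) (f : 'rV[R]_d -> Z -> R)
    eta W1 (s : 'I_n -> Z) (tau : 'I_n -> 'I_n) k : injective tau ->
  gd_iter f eta W1 (s \o tau) k = gd_iter f eta W1 s k.
Proof.
move=> tauI; elim: k => //= k ->.
by rewrite [in RHS](reindex_inj tauI).
Qed.

Section generalization.
Context (R : realType) (d n T : nat)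
  (dO dZ : measure_display) (Omega : measurableType dO) (Zt : measurableType dZ)
  (P : probability Omega R) (D : probability Zt R)
  (zs : 'I_n -> Omega -> Zt)
  (f : 'rV[R]_d -> Zt -> R) (eta : nat -> R) (W1 : 'rV[R]_d).
Hypothesis iid : iid_sample P D zs.
Hypothesis f0 : forall w z, 0 <= f w z.
Hypothesis df : forall z w, differentiable (f^~ z) w.
Hypothesis mf : forall w, measurable_fun setT (f w).

Lemma measurable_gd_loss dX (X : measurableType dX) (s : X -> 'I_n -> Zt)
    (zeta : X -> Zt) k : (forall j, measurable_fun setT (s^~ j)) ->
  measurable_fun setT zeta ->
  measurable_fun setT (fun x => f (gd_iter f eta W1 (s x) k) (zeta x)).
Proof.
move=> ms mzeta; apply: measurable_caratheodory => [z w|w|].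
- exact: differentiable_continuous.
- exact: measurableT_comp.
- by apply: measurable_gd_iter => // w j; exact: measurableT_comp.
Qed.

Lemma measurable_gd_sqgrad dX (X : measurableType dX) (s : X -> 'I_n -> Zt)
    (zeta : X -> Zt) k : (forall j, measurable_fun setT (s^~ j)) ->
  measurable_fun setT zeta ->
  measurable_fun setT
    (fun x => sqnorm2 (grad (f^~ (zeta x)) (gd_iter f eta W1 (s x) k))).
Proof.
move=> ms mzeta; apply: measurable_sqnorm2; apply: measurable_grad => // [w|].
  exact: measurableT_comp.
by apply: measurable_gd_iter => // w j; exact: measurableT_comp.
Qed.

Let W o := gd_iter f eta W1 (fun j => zs j o) T.

(** Transposing [i] and [j] preserves both the law of the sample and the output of gradient descent,
    while exchanging the two losses. *)
Lemma gd_loss_identically_distributed i j :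
  (\int[P]_o (f (W o) (zs j o))%:E = \int[P]_o (f (W o) (zs i o))%:E)%E.
Proof.
pose h (t : n.-tuple Zt) := (f (gd_iter f eta W1 (tnth t) T) (tnth t i))%:E.
have mh : measurable_fun setT h.
  apply/measurable_EFinP.
  by apply: measurable_gd_loss => [k|]; exact: measurable_tnth.
have h0 t : (0 <= h t)%E by rewrite lee_fin.
have tI : injective (tperm i j) by exact: perm_inj.
have := ge0_integral_iid (iid_sample_inj tI iid) iid mh h0.
have E (z : 'I_n -> Omega -> Zt) o : tnth (sample_tuple z o) = z^~ o.
  by apply/funext => k; rewrite tnth_mktuple.
under eq_integral => o _ do rewrite /h E tpermL.
under [X in _ = X -> _]eq_integral => o _ do rewrite /h E.
move=> <-; apply: eq_integral => o _.
by rewrite (gd_iter_perm _ _ _ (zs^~ o) _ tI).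
Qed.

(** By symmetry all [n] losses at sample points share one mean, which is therefore that of their
    average. *)
Lemma has_mean_gd_loss i m :
  has_mean P (fun o => emp_risk f (fun j => zs j o) (W o)) m ->
  has_mean P (fun o => f (W o) (zs i o)) m.
Proof.
move=> hE; have n0 : n%:R != 0 :> R by rewrite pnatr_eq0 -lt0n; case: n i {hE} => [[]|].
have mloss j : measurable_fun setT (fun o => f (W o) (zs j o)).
  by apply: measurable_gd_loss => [k|]; exact: iid.1.
(* Nonnegativity lets the whole sum dominate one summand; this supplies integrability of the single
   loss. *)
have le_emp o : f (W o) (zs i o) <= n%:R * emp_risk f (fun j => zs j o) (W o).
  rewrite /emp_risk mulrA divff// mul1r (bigD1 i)//= lerDl.
  by apply: sumr_ge0.
have hi : has_mean P (fun o => f (W o) (zs i o)) (expect P (fun o => f (W o) (zs i o))).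
  apply: integrable_has_mean.
  apply: le_integrable (has_meanZ n%:R hE).1 => //; first exact/measurable_EFinP.
  move=> o _ /=; rewrite lee_fin ger0_norm// ger0_norm//.
  exact: le_trans (le_emp o).
suff -> : m = expect P (fun o => f (W o) (zs i o)) by [].
case: hE => _ <-.
have /has_mean_sum hs : forall j, xpredT j -> has_mean P (fun o => f (W o) (zs j o))
    (expect P (fun o => f (W o) (zs i o))).
  move=> j _; apply: ge0_has_mean => //.
  by rewrite (gd_loss_identically_distributed i) (has_mean_integral hi).
have [_ ->] := has_meanZ n%:R^-1 (hs (index_enum 'I_n)).
by rewrite sumr_const card_ord -[X in _ * X]mulr_natl mulKf.
Qed.

End generalization.

(** Transposing the ghost point with the [i]-th sample point realizes the replace-one perturbation
    as a permutation of the extended sample. *)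
Lemma permute_tpermP (dZ : measure_display) (n : nat) (Zt : measurableType dZ)
    (i : 'I_n) (t : n.+1.-tuple Zt) :
  let t' := permute_tuple (tperm ord0 (lift ord0 i)) t in
  [/\ tnth t' ord0 = tnth t (lift ord0 i), tnth t' (lift ord0 i) = tnth t ord0 &
   forall j, j != i -> tnth t' (lift ord0 j) = tnth t (lift ord0 j)].
Proof.
split; rewrite ?tnth_mktuple ?tpermL ?tpermR// => j ji.
by rewrite tnth_mktuple tpermD// (inj_eq lift_inj) eq_sym.
Qed.


Unset Implicit Arguments.
Set Strict Implicit.

Theorem theorem11
  (R : realType) (d n T : nat)
  (dO dZ : measure_display) (Omega : measurableType dO) (Zt : measurableType dZ)
  (P : probability Omega R) (D : probability Zt R)
  (zs : 'I_n -> Omega -> Zt)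
  (f : 'rV[R]_d -> Zt -> R) (beta : R) (eta : nat -> R) (W1 : 'rV[R]_d)
  (Wstar : ('I_n -> Zt) -> 'rV[R]_d) (i : 'I_n) :
  iid_sample P D zs ->
  (* loss: non-negative, convex and beta-smooth in w for every z *)
  0 < beta ->
  (forall w z, 0 <= f w z) ->
  (forall z, convex_fun (f^~ z)) ->
  (forall z, smooth beta (f^~ z)) ->
  (* learning rates *)
  (forall t, (1 <= t <= T.+1)%N -> 0 <= eta t <= (2 * beta)^-1) ->
  (* W*_S is a minimizer of R_S *)
  (forall s w, emp_risk f s (Wstar s) <= emp_risk f s w) ->
  (* all expectations involved are well defined and finite *)
  (forall w, D.-integrable setT (fun z => (f w z)%:E)) ->
  let S := fun (o : Omega) (j : 'I_n) => zs j o in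
  let Rpop := fun w => Rintegral D setT (f w) in
  let AS := fun o => gd_out f eta W1 (S o) T in
  P.-integrable setT (fun o => (Rpop (AS o))%:E) ->
  P.-integrable setT (fun o => (emp_risk f (S o) (AS o))%:E) ->
  P.-integrable setT (fun o => (emp_risk f (S o) (Wstar (S o)))%:E) ->
  (forall t, (1 <= t <= T)%N ->
     P.-integrable setT
       (fun o => (sqnorm2 (grad (f^~ (zs i o)) (gd_iter f eta W1 (S o) t.-1)))%:E)) ->
  let eps_gen := expect P (fun o => Rpop (AS o) - emp_risk f (S o) (AS o)) in
  let eps_opt := expect P (fun o => emp_risk f (S o) (AS o)
                                    - emp_risk f (S o) (Wstar (S o))) in
  let eps_c := expect P (fun o => emp_risk f (S o) (Wstar (S o))) in
  let eps_path := \sum_(1 <= t < T.+1) eta t *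
       expect P (fun o => sqnorm2 (grad (f^~ (zs i o)) (gd_iter f eta W1 (S o) t.-1))) in
  let sum_eta := \sum_(1 <= t < T.+1) eta t in
  `| eps_gen | <=
    4 * Num.sqrt (2 * beta * (eps_opt + eps_c) * eps_path) / n%:R * Num.sqrt sum_eta
    + 8 * beta * eps_path / (n%:R ^+ 2) * sum_eta.
Proof.
move=> iid b0 f0 cf sf etab _ fint S Rpop AS iR iE iC iG.
pose eps_gen := expect P (fun o => Rpop (AS o) - emp_risk f (S o) (AS o)).
pose eps_opt := expect P (fun o => emp_risk f (S o) (AS o)
                                  - emp_risk f (S o) (Wstar (S o))).
pose eps_c := expect P (fun o => emp_risk f (S o) (Wstar (S o))).
pose eps_path := \sum_(1 <= t < T.+1) eta t *
  expect P (fun o => sqnorm2 (grad (f^~ (zs i o)) (gd_iter f eta W1 (S o) t.-1))).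
pose sum_eta := \sum_(1 <= t < T.+1) eta t.
rewrite -/eps_gen -/eps_opt -/eps_c -/eps_path -/sum_eta.
lazy zeta.
have mf w : measurable_fun setT (f w).
  by apply/measurable_EFinP; exact: measurable_int (fint w).
have df z w : differentiable (f^~ z) w by exact: (sf z).1.
have hR := integrable_has_mean iR; have hE := integrable_has_mean iE.
have hC := integrable_has_mean iC.
set gR := expect P _ in hR; set gE := expect P _ in hE; set gC := expect P _ in hC.
have genE : eps_gen = gR - gE by have [_] := has_meanB hR hE.
(* The risk of the minimizer cancels, leaving the expected empirical risk of the output. *)
have optE : eps_opt + eps_c = gE.
  have [_] := has_meanB hE hC; rewrite /eps_opt /expect => ->.
  by rewrite subrK.
have [mu [mu_perm mu_marg]] := exchangeable_extension iid.
pose s (t : n.+1.-tuple Zt) (j : 'I_n) := tnth t (lift ord0 j).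
have s_cons z o : s [tuple of z :: sample_tuple zs o] = S o.
  by apply/funext => j; rewrite /s tnthS tnth_mktuple.
have ms j : measurable_fun setT (s^~ j) by exact: measurable_tnth.
(* Means are transported from [P] to [mu] by integrating out the ghost coordinate. *)
have lift_mean (h : n.+1.-tuple Zt -> R) (g : Omega -> R) (m : R) :
    measurable_fun setT h -> (forall t, 0 <= h t) ->
    (forall o, \int[D]_z (h [tuple of z :: sample_tuple zs o])%:E = (g o)%:E)%E ->
    has_mean P g m -> has_mean mu h m.
  move=> mh h0 hg gm; apply: ge0_has_mean => //.
  rewrite (mu_marg (fun t => (h t)%:E)); last 2 first.
  - exact/measurable_EFinP.
  - by move=> t; rewrite lee_fin.
  by under eq_integral => o _ do rewrite hg; exact: has_mean_integral.
have lift_mean_cst (h : n.+1.-tuple Zt -> R) (g : Omega -> R) (m : R) :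
    measurable_fun setT h -> (forall t, 0 <= h t) ->
    (forall o z, h [tuple of z :: sample_tuple zs o] = g o) ->
    has_mean P g m -> has_mean mu h m.
  move=> mh h0 hg; apply: lift_mean => // o.
  under eq_integral => z _ do rewrite hg.
  by rewrite integral_cst// [X in (_ * X)%E]probability_setT mule1.
pose sw := @permute_tuple _ Zt n.+1 (tperm ord0 (lift ord0 i)).
have sw_mean (h : n.+1.-tuple Zt -> R) (m : R) :
    measurable_fun setT h -> (forall t, 0 <= h t) ->
    has_mean mu h m -> has_mean mu (h \o sw) m.
  move=> mh h0 hm; apply: ge0_has_mean.
  - by apply: measurableT_comp => //; exact: measurable_permute_tuple.
  - by move=> t; exact: h0.
  - rewrite -(has_mean_integral hm).
    apply: (mu_perm (fun t => (h t)%:E)).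
    + exact: perm_inj.
    + exact/measurable_EFinP.
    + by move=> t; rewrite lee_fin.
pose W k t := gd_iter f eta W1 (s t) k.
(* [L] is the loss at the unseen ghost point, with mean the population risk of the output; [F] is
   the loss at the training point [i]. *)
pose L t := f (W T t) (tnth t ord0).
pose F t := f (W T t) (s t i).
pose a k t := sqnorm2 (grad (f^~ (s t i)) (W k t)).
have hL : has_mean mu L gR.
  apply: (@lift_mean _ _ _ _ _ _ hR).
  - by apply: measurable_gd_loss => //; exact: measurable_tnth.
  - by move=> t; exact: f0.
  - move=> o; under eq_integral => z _ do rewrite /L /W s_cons tnth0.
    by rewrite /Rpop /Rintegral fineK//; exact: integrable_fin_num (fint _).
have hF : has_mean mu F gE.
  apply: (@lift_mean_cst _ (fun o => f (AS o) (zs i o))).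
  - exact: measurable_gd_loss.
  - by move=> t; exact: f0.
  - by move=> o z; rewrite /F /W s_cons.
  - exact: (has_mean_gd_loss iid f0 df mf i hE).
pose E k := expect P (fun o => sqnorm2 (grad (f^~ (zs i o)) (gd_iter f eta W1 (S o) k))).
have ma k : measurable_fun setT (a k) by exact: measurable_gd_sqgrad.
have a0 k t : 0 <= a k t by exact: sqnorm2_ge0.
have ha k : (1 <= k <= T)%N -> has_mean mu (a k.-1) (E k.-1).
  move=> kT; apply: (lift_mean_cst _ _ _ (ma _) (a0 _) _ (integrable_has_mean (iG _ kT))).
  by move=> o z; rewrite /a /W s_cons.
(* After the swap the ghost coordinate holds z_i, so both losses are taken at the same point and
   differ only through the trained parameter. *)
have hdiff : has_mean mu (fun t => L (sw t) - F t) (gR - gE).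
  apply: has_meanB hF; apply: sw_mean hL => [|t]; last exact: f0.
  by apply: measurable_gd_loss => //; exact: measurable_tnth.
have n0 : (0 : R) < n%:R by rewrite ltr0n (leq_ltn_trans (leq0n i)).
have eta0 k : (1 <= k <= T)%N -> 0 <= eta k.
  by move=> /andP[k1 kT]; have := etab k; rewrite k1 leqW// => /(_ isT) /andP[].
have H0 : 0 <= sum_eta by rewrite /sum_eta big_nat; exact: sumr_ge0.
(* The factor 2 comes from [sqnorm2B_le]; the two squared gradients have equal means by
   exchangeability, whence the mean [4 * eps_path]. The repeated range in the filter keeps the
   bounds on [k] available under [has_mean_sum]. *)
pose G t := \sum_(1 <= k < T.+1 | (1 <= k < T.+1)%N) eta k * (2 * (a k.-1 (sw t) + a k.-1 t)).
have hG : has_mean mu G (4 * eps_path).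
  rewrite /eps_path mulr_sumr big_nat.
  rewrite (eq_bigr (fun k => eta k * (2 * (E k.-1 + E k.-1)))); last by move=> k _; rewrite /E; ring.
  apply: has_mean_sum => k; rewrite ltnS => kT.
  apply: has_meanZ; apply: has_meanZ; apply: has_meanD; last exact: ha.
  by apply: sw_mean => //; exact: ha.
have stab t : sqnorm2 (W T (sw t) - W T t) <= sum_eta / n%:R ^+ 2 * G t.
  have [_ sw1 sw2] := permute_tpermP i t.
  rewrite mulrAC ler_pdivlMr ?exprn_gt0// mulrC.
  apply: le_trans (@gd_iter_stable R d Zt n f beta eta W1 b0 cf sf (s (sw t)) (s t) i T _ _) _.
  - by move=> j ji; rewrite /s sw2.
  - by move=> k /andP[k1 kT]; apply: etab; rewrite k1 leqW.
  rewrite ler_wpM2l// /G big_nat; apply: ler_sum => k; rewrite ltnS => kT.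
  by rewrite ler_wpM2l ?eta0// sqnorm2B_le.
(* The weight [l] stays constant while means are taken, since its optimal value depends on those
   means. *)
have bound l : 0 < l -> `|gR - gE| <=
    2 * beta * l * gE + (l^-1 / 2 + beta) * (sum_eta / n%:R ^+ 2 * (4 * eps_path)).
  move=> l0; apply: (has_mean_norm_le hdiff
    (has_meanD (has_meanZ (2 * beta * l) hF)
      (has_meanZ (l^-1 / 2 + beta) (has_meanZ (sum_eta / n%:R ^+ 2) hG)))) => t.
  have [sw0 _ _] := permute_tpermP i t.
  rewrite /L sw0.
  apply: le_trans (loss_diff_le b0 (cf _) (sf _) (W T (sw t)) (W T t) (fun v => f0 v _) l0) _.
  have c0 : 0 <= l^-1 / 2 + beta by rewrite addr_ge0 ?divr_ge0 ?invr_ge0 ?ltW.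
  by rewrite lerD2l ler_wpM2l.
have gE0 : 0 <= gE by apply: has_mean_ge0 hF => t; exact: f0.
have path0 : 0 <= eps_path.
  rewrite /eps_path big_nat; apply: sumr_ge0 => k; rewrite ltnS => kT.
  by rewrite mulr_ge0 ?eta0// (has_mean_ge0 (a0 _) (ha _ kT)).
rewrite genE optE.
set K := sum_eta / n%:R ^+ 2 * (4 * eps_path) in bound.
have K0 : 0 <= K by rewrite !mulr_ge0// invr_ge0 exprn_ge0// ltW.
(* The summand [beta * K] is independent of [l] and moves to the left before optimizing. *)
have := @le_2sqrtM R (`|gR - gE| - beta * K) (2 * beta * gE) (K / 2).
move=> /(_ _ _ _) main.
have {}main : `|gR - gE| - beta * K <= 2 * Num.sqrt (2 * beta * gE * (K / 2)).
  apply: main; rewrite ?mulr_ge0 ?divr_ge0// ?ltW// => l l0.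
  by have := bound _ l0; lra.
have q0 : 0 <= 2 * beta * gE * eps_path by rewrite !mulr_ge0// ltW.
(* Comparing squares, the right side is exactly twice the left, so a factor [sqrt 2] is given away
   here. *)
have sq : Num.sqrt (2 * beta * gE * (K / 2)) <=
    2 * Num.sqrt (2 * beta * gE * eps_path) / n%:R * Num.sqrt sum_eta.
  rewrite -[leRHS]ger0_norm; last by rewrite !mulr_ge0 ?sqrtr_ge0 ?invr_ge0 ?ltW.
  rewrite -sqrtr_sqr ler_wsqrtr// !exprMn !sqr_sqrtr//.
  have -> : 2 ^+ 2 * (2 * beta * gE * eps_path) * n%:R^-1 ^+ 2 * sum_eta = 2 * (2 * beta * gE * (K / 2)).
    by rewrite /K; field; rewrite gt_eqF.
  by rewrite ler_peMl ?ler1n// !mulr_ge0 ?divr_ge0// ltW.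
(* Here [beta * K] is exactly half of the target term. *)
have bK : beta * K <= 8 * beta * eps_path / n%:R ^+ 2 * sum_eta.
  have -> : 8 * beta * eps_path / n%:R ^+ 2 * sum_eta = 2 * (beta * K).
    by rewrite /K; field; rewrite gt_eqF.
  by rewrite ler_peMl ?ler1n// mulr_ge0// ltW.
have := ler_wpM2l (ler0n R 2) sq.
have -> : 2 * (2 * Num.sqrt (2 * beta * gE * eps_path) / n%:R * Num.sqrt sum_eta) =
  4 * Num.sqrt (2 * beta * gE * eps_path) / n%:R * Num.sqrt sum_eta by ring.
by lra.
Qed.
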